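(* Let $n_1\ge n_2\ge 1$ be integers and $\sigma>0$. Consider the model $y=\theta^*+\varepsilon$, where $\theta^*\in\mathcal{M}_{V_0}^{n_1,n_2}$ and $\varepsilon\in\mathbb{R}^{n_1\times n_2}$ has i.i.d. $\mathcal{N}(0,\sigma^2)$ entries. For any $V_0\ge 0$, it holds that $$\inf_{\tilde\theta}\;\sup_{\theta^*\in\mathcal{M}_{V_0}^{n_1,n_2}}\mathbb{E}\Big[\frac{1}{n_1n_2}\|\tilde\theta-\theta^*\|_F^2\Big]\;\gtrsim\;\Big[\frac{\sigma^2}{n_2}+\Big(\frac{\sigma^2V_0}{n_1n_2}\Big)^{2/3}\Big]\wedge\sigma^2,$$ where the infimum is taken over all estimators $\tilde\theta$ measurable with respect to the observation $y$.
   Context: A matrix $\theta\in\mathbb{R}^{n_1\times n_2}$ is anti-Monge if $\theta_{i,j}+\theta_{k,\ell}\ge\theta_{i,\ell}+\theta_{k,j}$ for all $1\le i\le k\le n_1$, $1\le j\le\ell\le n_2$; the set of such matrices is $\mathcal{M}^{n_1,n_2}$. For $\theta\in\mathcal{M}^{n_1,n_2}$, $V(\theta):=\theta_{1,1}+\theta_{n_1,n_2}-\theta_{n_1,1}-\theta_{1,n_2}$. For $V_0\ge 0$, $\mathcal{M}_{V_0}^{n_1,n_2}:=\{\theta\in\mathcal{M}^{n_1,n_2}:V(\theta)\le V_0\}$. $\|\cdot\|_F$ is the Frobenius norm; $a\wedge b=\min(a,b)$; $a\gtrsim b$ means $a\ge cb$ for a universal constant $c>0$ (independent of all parameters). *)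

(* Defs.v *)
From HB Require Import structures.
From mathcomp Require Import all_boot all_order all_algebra.
From mathcomp Require Import all_classical all_reals all_analysis.

Set Implicit Arguments.
Unset Strict Implicit.
Unset Printing Implicit Defensive.

Import Order.TTheory GRing.Theory Num.Theory.
Import numFieldNormedType.Exports.

Local Open Scope classical_set_scope.
Local Open Scope ring_scope.

(* The product sigma-algebra on matrices, generated by the entry maps, in the
   same way as the library equips [n.-tuple T]. *)
Definition measure_matrix_display : measure_display -> measure_display.
Proof. exact. Qed.

Section measurable_matrix.
Context {d} {T : measurableType d} (m n : nat).

Definition g_sigma_entries : set (set 'M[T]_(m, n)) :=
  <<s \bigcup_(ij in [set: 'I_m * 'I_n])
        preimage_set_system setT (fun A : 'M[T]_(m, n) => A ij.1 ij.2)
          measurable >>.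

Let entries_set0 : g_sigma_entries set0.
Proof. exact: sigma_algebra0. Qed.

Let entries_setC A : g_sigma_entries A -> g_sigma_entries (~` A).
Proof. by move=> mA; rewrite -setTD; exact: sigma_algebraCD. Qed.

Let entries_bigcup (F : (set 'M[T]_(m, n))^nat) :
  (forall i, g_sigma_entries (F i)) -> g_sigma_entries (\bigcup_i (F i)).
Proof. exact: sigma_algebra_bigcup. Qed.

HB.instance Definition _ := @isMeasurable.Build (measure_matrix_display d)
  'M[T]_(m, n) g_sigma_entries entries_set0 entries_setC entries_bigcup.

End measurable_matrix.

Definition anti_monge (R : realType) (n1 n2 : nat)
    (theta : 'M[R]_(n1, n2)) : Prop :=
  forall (i k : 'I_n1) (j l : 'I_n2), (i <= k)%N -> (j <= l)%N ->
    theta i l + theta k j <= theta i j + theta k l.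

(* Dimensions are successors so that the corner entries exist. *)
Definition total_var (R : realType) (m1 m2 : nat)
    (theta : 'M[R]_(m1.+1, m2.+1)) : R :=
  theta ord0 ord0 + theta ord_max ord_max
  - theta ord_max ord0 - theta ord0 ord_max.

Definition anti_monge_class (R : realType) (m1 m2 : nat) (V0 : R) :
    set 'M[R]_(m1.+1, m2.+1) :=
  [set theta | anti_monge theta /\ total_var theta <= V0].

Definition frobenius_norm (R : realType) (n1 n2 : nat)
    (A : 'M[R]_(n1, n2)) : R :=
  Num.sqrt (\sum_i \sum_j A i j ^+ 2).

Definition mutually_independent d (T : measurableType d) (R : realType)
    (P : probability T R) (I : finType) (X : I -> {RV P >-> R}) : Prop :=
  forall (J : {set I}) (B : I -> set R), (forall i, measurable (B i)) ->
    P (\bigcap_(i in [set` J]) (X i @^-1` B i)) =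
    (\prod_(i in J) P (X i @^-1` B i))%E.

(* The laws are compared on measurable sets only: the value of a measure
   outside the sigma-algebra is unspecified. [sigma] is the standard
   deviation. *)
Definition iid_normal d (T : measurableType d) (R : realType)
    (P : probability T R) (I : finType) (sigma : R)
    (X : I -> {RV P >-> R}) : Prop :=
  mutually_independent X /\
  forall (i : I) (B : set R), measurable B ->
    distribution P (X i) B = normal_prob 0 sigma B.

Section risk.
Context d (T : measurableType d) (R : realType) (P : probability T R).
Context (m1 m2 : nat).
Variable eps : 'I_m1.+1 * 'I_m2.+1 -> {RV P >-> R}.

Definition observation (theta : 'M[R]_(m1.+1, m2.+1)) (w : T) :
    'M[R]_(m1.+1, m2.+1) :=
  theta + \matrix_(i, j) eps (i, j) w.

Definition risk (est : 'M[R]_(m1.+1, m2.+1) -> 'M[R]_(m1.+1, m2.+1))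
    (theta : 'M[R]_(m1.+1, m2.+1)) : \bar R :=
  'E_P[fun w => (m1.+1%:R * m2.+1%:R)^-1 *
         frobenius_norm (est (observation theta w) - theta) ^+ 2].

(* An estimator measurable with respect to the observation [y] is a measurable
   function of [y], and the same function is used for every [theta]. *)
Definition minimax_risk (V0 : R) : \bar R :=
  ereal_inf [set ereal_sup [set risk est theta
                           | theta in @anti_monge_class R m1 m2 V0]
            | est in [set: {mfun 'M[R]_(m1.+1, m2.+1)
                              >-> 'M[R]_(m1.+1, m2.+1)}]].

End risk.

(* Main.v *)
(* Assouad's method on a hypercube of anti-Monge matrices. Group the columns
   into blocks of width w, let b(j) = j / w be the block of column j, and
   attach to the bits s the matrix 2 h i b(j) + h s(i, b(j)). The term
   2 h i b(j) has second difference 2 h across every row step and block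
   boundary, which absorbs that of the bits, and the total variation is of
   order h n1 n2 / w, or 0 when there is a single block. Flipping a bit shifts
   the mean by a vector of norm at most h sqrt w, undetectable when
   h^2 w = sigma^2 / 2, and changes each entry of one block by h; hence the
   risk is at least of order h^2. The least w compatible with V0 gives the rate.

   Indistinguishability rests on a change of measure. The law of the noise is
   unchanged when one entry is resampled independently, so a shift of the
   noise reduces, one entry at a time, to the one-dimensional Gaussian
   likelihood ratio. *)

Require Import Defs.
From mathcomp Require Import all_boot all_order all_algebra.
From mathcomp Require Import all_classical all_reals all_analysis.
From mathcomp Require Import measurable_realfun ring lra.

Set Implicit Arguments.
Unset Strict Implicit.
Unset Printing Implicit Defensive.

Import Order.TTheory GRing.Theory Num.Theory.
Import numFieldNormedType.Exports.

Local Open Scope classical_set_scope.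
Local Open Scope ring_scope.

(** * Integration against a measure given by a density *)

Section density.
Local Open Scope ereal_scope.
Context d (T : measurableType d) (R : realType).
Variables (mu nu : {measure set T -> \bar R}) (g : T -> R).
Hypotheses (mg : measurable_fun setT g) (g0 : forall x, (0 <= g x)%R).
Hypothesis nuE : forall A, measurable A -> nu A = \int[mu]_(x in A) (g x)%:E.

Import HBNNSimple.

Let ge0_integral_density_nnsfun (h : {nnsfun T >-> R}) :
  \int[nu]_x (h x)%:E = \int[mu]_x ((h x)%:E * (g x)%:E).
Proof.
under [LHS]eq_integral do rewrite fimfunE -fsumEFin//.
rewrite [LHS]ge0_integral_fsum//; last 2 first.
  - by move=> r; exact/measurable_EFinP/measurableT_comp.
  - by move=> n x _; rewrite EFinM nnfun_muleindic_ge0.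
under [RHS]eq_integral.
  move=> x xD; rewrite fimfunE -fsumEFin// muleC ge0_mule_fsumr; last first.
    by move=> r; rewrite EFinM nnfun_muleindic_ge0.
  over.
rewrite [RHS]ge0_integral_fsum//; last 2 first.
  - move=> r; apply/measurable_EFinP/measurable_funM => //.
    exact: measurableT_comp.
  - move=> r x _; apply: mule_ge0; first by rewrite lee_fin.
    by rewrite EFinM nnfun_muleindic_ge0.
apply: eq_fsbigr => r _; rewrite integralZl_indic_nnsfun//.
rewrite integral_indic//= setIT nuE//.
rewrite [X in _ * X]integral_mkcond.
(* The sum runs over real values [r]. For [r < 0] the preimage is empty and both sides vanish; for
   [r >= 0] the constant can be moved inside a nonnegative integral. *)
have [r0|r0] := ltP r 0%R.
  rewrite preimage_nnfun0// integral0_eq ?mule0; last first.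
    by move=> x _; rewrite patchE in_set0.
  by rewrite integral0_eq// => x _; rewrite indicE in_set0/= mulr0 mule0.
rewrite -ge0_integralZl//; last 2 first.
  - apply/(measurable_restrictT _ _).1 => //.
    exact/measurable_funTS/measurable_EFinP.
  - by move=> x _; rewrite patchE; case: ifP => // _; rewrite lee_fin.
apply: eq_integral => x _; rewrite patchE indicE.
by case: ifP => _; rewrite ?mulr1 ?mulr0 ?mule0// muleC.
Qed.

(** Holds for simple functions by additivity, then for [f] by monotone convergence on both sides
    along one approximating sequence. It turns Gaussian integrals into Lebesgue integrals. *)
Lemma ge0_integral_density (f : T -> \bar R) :
  measurable_fun setT f -> (forall x, 0 <= f x) ->
  \int[nu]_x f x = \int[mu]_x (f x * (g x)%:E).
Proof.
move=> mf f0; pose f_ := nnsfun_approx measurableT mf.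
transitivity (limn (fun n => \int[nu]_x (f_ n x)%:E)).
  rewrite -monotone_convergence//=.
  - apply: eq_integral => x _; apply/esym/cvg_lim => //=.
    exact: cvg_nnsfun_approx.
  - by move=> n; exact/measurable_EFinP.
  - by move=> n x _; rewrite lee_fin.
  - by move=> x _ a b ab; rewrite lee_fin//; exact/lefP/nd_nnsfun_approx.
transitivity (limn (fun n => \int[mu]_x ((f_ n x)%:E * (g x)%:E))).
  by congr (limn _); apply/funext => n; exact: ge0_integral_density_nnsfun.
rewrite -monotone_convergence//=.
- apply: eq_integral => x _; apply/cvg_lim => //=.
  apply: cvgeZr => //; exact: cvg_nnsfun_approx.
- by move=> n; apply/measurable_EFinP/measurable_funM.
- by move=> n x _; rewrite mule_ge0// lee_fin.
- move=> x _ a b ab; rewrite lee_wpmul2r// lee_fin//.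
  exact/lefP/nd_nnsfun_approx.
Qed.

End density.

(** * Translation of a one-dimensional Gaussian *)

Section normal_shift.
Local Open Scope ereal_scope.
Context (R : realType).
Local Notation mu := (@lebesgue_measure R).

(** Lebesgue measure is determined by its values on half-open intervals, and a translation preserves
    their lengths. *)
Lemma lebesgue_measureD (v : R) (A : set R) : measurable A ->
  pushforward mu (+%R v : _ -> measurableTypeR R) A = mu A.
Proof.
move=> mA.
have mD : measurable_fun setT (+%R v : measurableTypeR R -> measurableTypeR R).
  exact: measurable_funD.
apply/esym/lebesgue_measure_unique => // _ [[a b]] _ <-.
rewrite /= /pushforward.
set B := (X in _ = mu X).
have -> : B = `](a - v)%R, (b - v)%R]%classic.
  by apply/funext => x /=; rewrite !in_itv/= ltrBlDl lerBrDl.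
rewrite !lebesgue_measure_itv/= !lte_fin ltrD2r; case: ifP => // _.
by rewrite -!EFinB; congr (_%:E); ring.
Qed.

Lemma ge0_integral_lebesgueD (v : R) (f : R -> \bar R) :
  measurable_fun setT f -> (forall x, 0 <= f x) ->
  \int[mu]_x f (v + x)%R = \int[mu]_x f x.
Proof.
move=> mf f0.
have mD : measurable_fun setT (+%R v : measurableTypeR R -> measurableTypeR R).
  exact: measurable_funD.
rewrite -[LHS](@ge0_integral_pushforward _ _ _ _ _ _ mD mu setT)//.
by apply: eq_measure_integral => A mA _; exact: lebesgue_measureD.
Qed.

(* Likelihood ratio of N(v, s^2) against N(0, s^2). *)
Definition normal_lr (s v x : R) : R :=
  expR (v * x / s ^+ 2 - v ^+ 2 / (s ^+ 2 *+ 2)).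

Lemma measurable_normal_lr (s v : R) : measurable_fun setT (normal_lr s v).
Proof.
apply: measurableT_comp => //; apply: measurable_funB => //.
by apply: measurable_funM => //; exact: measurable_funM.
Qed.

Lemma normal_lr_ge0 (s v x : R) : (0 <= normal_lr s v x)%R.
Proof. exact: expR_ge0. Qed.

Lemma normal_pdfD (s v x : R) : s != 0%R ->
  normal_pdf 0 s (x - v) = (normal_lr s v x * normal_pdf 0 s x)%R.
Proof.
move=> s0; rewrite !normal_pdfE// /normal_lr mulrCA; congr (_ * _)%R.
by rewrite /normal_fun -expRD; congr expR; field.
Qed.

Lemma ge0_integral_normal_prob (m s : R) (f : R -> \bar R) :
  measurable_fun setT f -> (forall x, 0 <= f x) ->
  \int[normal_prob m s]_x f x = \int[mu]_x (f x * (normal_pdf m s x)%:E).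
Proof.
move=> mf f0; apply: ge0_integral_density => //.
- exact: measurable_normal_pdf.
- exact: normal_pdf_ge0.
Qed.

(** One-dimensional change of measure: translating the Lebesgue integral moves the shift from [f] to
    the density, where [normal_pdfD] turns it into the factor [normal_lr]. *)
Lemma ge0_integral_normalD (s v : R) (f : R -> \bar R) : s != 0%R ->
  measurable_fun setT f -> (forall x, 0 <= f x) ->
  \int[normal_prob 0 s]_x f (v + x)%R =
  \int[normal_prob 0 s]_x (f x * (normal_lr s v x)%:E).
Proof.
move=> s0 mf f0.
have mD : measurable_fun setT (+%R v : measurableTypeR R -> measurableTypeR R).
  exact: measurable_funD.
have p0 := @normal_pdf_ge0 R 0 s.
have mfL : measurable_fun setT (fun x : R => f x * (normal_lr s v x)%:E).
  apply: emeasurable_funM => //; apply/measurable_EFinP.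
  exact: measurable_normal_lr.
have mfLp : measurable_fun setT
    (fun x : R => f x * (normal_lr s v x)%:E * (normal_pdf 0 s x)%:E).
  apply: emeasurable_funM => //; apply/measurable_EFinP.
  exact: measurable_normal_pdf.
rewrite [LHS]ge0_integral_normal_prob//; last exact: (measurableT_comp mf).
rewrite [RHS]ge0_integral_normal_prob//; last first.
  by move=> x; rewrite mule_ge0// lee_fin normal_lr_ge0.
rewrite -[RHS](ge0_integral_lebesgueD v)//; last first.
  by move=> x; rewrite !mule_ge0 ?lee_fin ?normal_lr_ge0 ?p0.
apply: eq_integral => x _.
by rewrite -muleA -EFinM -normal_pdfD// addrAC subrr add0r.
Qed.

End normal_shift.

(** * The product sigma-algebra on matrices and its generating boxes *)

Section matrix_measurability.
Context d (T : measurableType d) (m n : nat).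

Lemma measurable_entry (i : 'I_m) (j : 'I_n) :
  measurable_fun setT (fun A : 'M[T]_(m, n) => A i j).
Proof.
move=> _ B mB; rewrite setTI; apply: sub_sigma_algebra.
by exists (i, j) => //; exists B => //; rewrite setTI.
Qed.

Lemma measurable_fun_matrix d' (S : measurableType d') (f : S -> 'M[T]_(m, n)) :
  (forall i j, measurable_fun setT (fun x => f x i j)) -> measurable_fun setT f.
Proof.
move=> mf.
apply: (measurability (\bigcup_(ij in [set: 'I_m * 'I_n])
  preimage_set_system setT (fun A : 'M[T]_(m, n) => A ij.1 ij.2) measurable)).
  by [].
move=> _ [_ [[i j] _ [B mB <-]] <-].
by rewrite [X in f @^-1` X]setTI; exact: mf.
Qed.

Definition matrix_box (B : 'I_m * 'I_n -> set T) : set 'M[T]_(m, n) :=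
  [set A | forall ij, B ij (A ij.1 ij.2)].

Definition measurable_boxes : set (set 'M[T]_(m, n)) :=
  [set matrix_box B | B in [set B | forall ij, measurable (B ij)]].

Lemma matrix_boxE B : matrix_box B =
  \bigcap_(ij in setT) ((fun A : 'M[T]_(m, n) => A ij.1 ij.2) @^-1` B ij).
Proof.
by apply/seteqP; split => A /= AB ij; [move=> _; exact: AB|exact: AB].
Qed.

Lemma measurable_matrix_box B : (forall ij, measurable (B ij)) ->
  measurable (matrix_box B).
Proof.
move=> mB; rewrite matrix_boxE; apply: fin_bigcap_measurable => // ij _.
by rewrite -[X in _ X]setTI; exact: measurable_entry.
Qed.

Lemma measurable_boxesT : measurable_boxes setT.
Proof. by exists (fun=> setT) => //; apply/seteqP; split. Qed.

Lemma setI_closed_boxes : setI_closed measurable_boxes.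
Proof.
move=> _ _ [B mB <-] [C mC <-]; exists (fun ij => B ij `&` C ij).
  by move=> ij; exact: measurableI.
by apply/seteqP; split => [A AB|A [AB AC] ij]; split=> // => ij; case: (AB ij).
Qed.

Lemma measurable_matrixE : @measurable _ 'M[T]_(m, n) = <<s measurable_boxes >>.
Proof.
apply/seteqP; split; apply: smallest_sub; try exact: smallest_sigma_algebra.
- move=> _ [[i j] _ [B mB <-]]; apply: sub_sigma_algebra.
  exists (fun kl => if kl == (i, j) then B else setT).
    by move=> kl /=; case: ifP.
  rewrite setTI; apply/seteqP; split => A /=.
    by move=> /(_ (i, j)); rewrite eqxx.
  by move=> AB kl; case: eqP => [->|].
- by move=> _ [B mB <-]; exact: measurable_matrix_box.
Qed.

(** Boxes form a pi-system that generates the sigma-algebra and contains the whole space. On boxes,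
    independence expresses the law of the noise as a product. *)
Lemma matrix_measure_unique (R : realType)
    (P Q : {measure set 'M[T]_(m, n) -> \bar R}) :
    (P setT < +oo)%E ->
    (forall B, (forall ij, measurable (B ij)) ->
      P (matrix_box B) = Q (matrix_box B)) ->
  forall A, measurable A -> P A = Q A.
Proof.
move=> Poo PQ; apply: (measure_unique measurable_boxes (fun=> setT)).
- exact: measurable_matrixE.
- exact: setI_closed_boxes.
- by move=> _; exact: measurable_boxesT.
- by rewrite bigcup_const.
- by move=> _ [B mB <-]; exact: PQ.
- by [].
Qed.

End matrix_measurability.

(** * Change of measure for the noise matrix *)

Section resampling.
Context d (T : measurableType d) (R : realType) (P : probability T R).
Context (m n : nat) (sigma : R) (eps : 'I_m * 'I_n -> {RV P >-> R}).
Hypothesis sigma0 : sigma != 0.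
Hypothesis iid : iid_normal sigma eps.

Definition noise (w : T) : 'M[R]_(m, n) := \matrix_(i, j) eps (i, j) w.

Lemma measurable_noise : measurable_fun setT noise.
Proof.
apply: measurable_fun_matrix => i j.
rewrite (_ : (fun _ => _) = eps (i, j)) //.
by apply/funext => w; rewrite mxE.
Qed.

Definition set_entry (A : 'M[R]_(m, n)) ij x : 'M[R]_(m, n) :=
  \matrix_(i, j) if (i, j) == ij then x else A i j.

Lemma measurable_set_entry ij :
  measurable_fun setT (fun p : 'M[R]_(m, n) * R => set_entry p.1 ij p.2).
Proof.
apply: measurable_fun_matrix => i j; rewrite /set_entry.
under eq_fun do rewrite mxE.
case: eqP => _; first exact: measurable_snd.
by apply: (measurableT_comp (measurable_entry i j)); exact: measurable_fst.
Qed.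

(** The noise, and the noise with entry [ij] replaced by a fresh draw under [P \x N], give every box
    the same probability, hence have the same law. Tonelli then integrates the fresh draw first,
    which isolates a single Gaussian variable. *)
Lemma ge0_integral_resample ij (phi : 'M[R]_(m, n) -> \bar R) :
  measurable_fun setT phi -> (forall A, 0 <= phi A)%E ->
  (\int[P]_w phi (noise w) =
   \int[P]_w \int[normal_prob 0 sigma]_x phi (set_entry (noise w) ij x))%E.
Proof.
move=> mphi phi0.
pose N : probability _ R := normal_prob 0 sigma.
pose r (p : T * R) := set_entry (noise p.1) ij p.2.
have mr : measurable_fun setT (r : T * measurableTypeR R -> 'M[R]_(m, n)).
  have mp : measurable_fun setT (fun p : T * R => (noise p.1, p.2)).
    apply: measurable_fun_pair => //.
    exact: (measurableT_comp measurable_noise).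
  exact: (measurableT_comp (measurable_set_entry ij) mp).
have -> : (\int[P]_w phi (noise w) = \int[pushforward P noise]_A phi A)%E.
  by rewrite ge0_integral_pushforward//; exact: measurable_noise.
transitivity (\int[pushforward (P \x N)%E r]_A phi A)%E.
  have mnoise := measurable_noise.
  apply: eq_measure_integral => A mA _.
  apply: matrix_measure_unique mA => //.
    by rewrite /= /pushforward preimage_setT probability_setT ltry.
  move=> B mB.
  have [indep law] := iid.
  have nB : P (noise @^-1` matrix_box B) =
      (\prod_(kl in [set: 'I_m * 'I_n]%SET) P (eps kl @^-1` B kl))%E.
    rewrite -(indep _ _ mB); congr (P _); apply/seteqP; split => w /=.
      by move=> wB [k l] _; have /= := wB (k, l); rewrite mxE.
    by move=> wB [k l] /=; rewrite mxE; apply: wB; rewrite /= inE.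
  (* The sides other than [ij] constrain only the old noise, and the side [ij] only the fresh draw,
     so the preimage of a box is a measurable rectangle. *)
  pose J : {set 'I_m * 'I_n} := [set~ ij]%SET.
  have rB : r @^-1` matrix_box B =
      (\bigcap_(kl in [set` J]) (eps kl @^-1` B kl)) `*` B ij.
    apply/seteqP; split => -[w x] /=.
      move=> rB; split => [[k l] /=|].
        rewrite !inE => klij; have /= := rB (k, l).
        by rewrite !mxE (negbTE klij).
      by have := rB ij; rewrite mxE -surjective_pairing eqxx.
    move=> [wB xB] [k l] /=; rewrite !mxE.
    have [->//|klij] := eqVneq.
    by apply: wB; rewrite /= !inE.
  have mC : measurable (\bigcap_(kl in [set` J]) (eps kl @^-1` B kl)).
    apply: fin_bigcap_measurable => [|kl _]; first exact: finite_finset.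
    by rewrite -[X in _ X]setTI; exact: measurable_funP.
  rewrite /= /pushforward nB rB product_measure1E//; last exact: mB.
  rewrite (bigD1 ij) ?inE//= muleC; congr (_ * _)%E; last exact: law.
  transitivity (\prod_(kl in J) P (eps kl @^-1` B kl))%E.
    by apply: eq_bigl => kl; rewrite !inE.
  exact/esym/(indep J B mB).
have := ge0_integral_pushforward mr (P \x N)%E measurableT mphi
  (fun A _ => phi0 A).
move=> ->; rewrite preimage_setT fubini_tonelli1//.
- exact: (measurableT_comp mphi).
- by move=> p; exact: phi0.
Qed.

Lemma measurable_matrix_addr (V : 'M[R]_(m, n)) :
  measurable_fun setT (fun A : 'M[R]_(m, n) => A + V).
Proof.
apply: measurable_fun_matrix => i j.
under eq_fun do rewrite mxE.
by apply: measurable_funD => //; exact: measurable_entry.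
Qed.

(** Once entry [(i, j)] is resampled on both sides, it is the inner integration variable and the
    other entries are frozen, so the one-dimensional formula applies. *)
Lemma ge0_integral_noiseD_delta i j (v : R) (phi : 'M[R]_(m, n) -> \bar R) :
  measurable_fun setT phi -> (forall A, 0 <= phi A)%E ->
  (\int[P]_w phi (noise w + v *: delta_mx i j)%R =
   \int[P]_w (phi (noise w) * (normal_lr sigma v (noise w i j))%:E))%E.
Proof.
move=> mphi phi0.
have mL : measurable_fun setT
    (fun A : 'M[R]_(m, n) => phi A * (normal_lr sigma v (A i j))%:E)%E.
  apply: emeasurable_funM => //; apply/measurable_EFinP.
  apply: measurableT_comp; first exact: measurable_normal_lr.
  exact: measurable_entry.
rewrite (@ge0_integral_resample (i, j)
  (fun A => phi (A + v *: delta_mx i j))); last 2 first.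
- exact: (measurableT_comp mphi (measurable_matrix_addr _)).
- by [].
rewrite (@ge0_integral_resample (i, j)
  (fun A => phi A * (normal_lr sigma v (A i j))%:E)%E)//; last first.
  by move=> A; rewrite mule_ge0// lee_fin normal_lr_ge0.
apply: eq_integral => w _.
pose psi x := phi (set_entry (noise w) (i, j) x).
have mpsi : measurable_fun setT psi.
  apply: (measurableT_comp mphi); apply: measurable_fun_matrix => k l.
  under eq_fun do rewrite mxE.
  by case: eqP => _; [exact: measurable_id|exact: measurable_cst].
have := ge0_integral_normalD v sigma0 mpsi (fun x => phi0 _).
rewrite /psi => E; under [RHS]eq_integral do rewrite mxE eqxx.
rewrite -E; apply: eq_integral => x _; congr (phi _).
apply/matrixP => k l; rewrite !mxE [(k, l) == _]xpair_eqE.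
by have [->|_] := eqVneq k i; have [->|_] := eqVneq l j => //=; ring.
Qed.

(** Likelihood ratio at [A] of the noise shifted by [V] against the noise itself. *)
Definition noise_lr (V A : 'M[R]_(m, n)) : R :=
  \prod_ij normal_lr sigma (V ij.1 ij.2) (A ij.1 ij.2).

Lemma noise_lr_ge0 V A : 0 <= noise_lr V A.
Proof. by apply: prodr_ge0 => ij _; exact: normal_lr_ge0. Qed.

Let measurable_prod_lr (r : seq ('I_m * 'I_n)) (V : 'M[R]_(m, n)) :
  measurable_fun setT (fun A : 'M[R]_(m, n) =>
    \prod_(ij <- r) normal_lr sigma (V ij.1 ij.2) (A ij.1 ij.2)).
Proof.
apply: measurable_prod => ij _.
apply: measurableT_comp; first exact: measurable_normal_lr.
exact: measurable_entry.
Qed.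

Lemma measurable_noise_lr V : measurable_fun setT (noise_lr V).
Proof. exact: measurable_prod_lr. Qed.

Lemma ge0_integral_noiseD (V : 'M[R]_(m, n)) (phi : 'M[R]_(m, n) -> \bar R) :
  measurable_fun setT phi -> (forall A, 0 <= phi A)%E ->
  (\int[P]_w phi (noise w + V)%R =
   \int[P]_w (phi (noise w) * (noise_lr V (noise w))%:E))%E.
Proof.
pose S r := \sum_(ij <- r) V ij.1 ij.2 *: delta_mx ij.1 ij.2 : 'M[R]_(m, n).
(* Induction on the list of shifted entries, with [psi] general because the induction hypothesis is
   applied to a translate of it. *)
have step r : uniq r -> forall psi : 'M[R]_(m, n) -> \bar R,
    measurable_fun setT psi -> (forall A, 0 <= psi A)%E ->
    (\int[P]_w psi (noise w + S r)%R = \int[P]_w (psi (noise w) *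
      (\prod_(ij <- r)
        normal_lr sigma (V ij.1 ij.2) (noise w ij.1 ij.2))%:E))%E.
  elim: r => [_ psi mpsi psi0|[i j] r IH /= /andP[ijr ur] psi mpsi psi0].
    by apply: eq_integral => w _; rewrite /S !big_nil addr0 mule1.
  rewrite /S big_cons -/(S r).
  under eq_integral do rewrite addrA addrAC.
  rewrite (IH ur (fun A => psi (A + V i j *: delta_mx i j)))//; last first.
    exact: (measurableT_comp mpsi (measurable_matrix_addr _)).
  (* The factors already produced do not see the shift of entry [(i, j)], since [r] does not contain
     it. *)
  pose L (A : 'M[R]_(m, n)) :=
    \prod_(kl <- r) normal_lr sigma (V kl.1 kl.2) (A kl.1 kl.2).
  have L_shift A : L (A + V i j *: delta_mx i j) = L A.
    apply: eq_big_seq => -[k l] klr /=; rewrite !mxE.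
    have : (k, l) != (i, j) by apply: contraNneq ijr => <-.
    by rewrite xpair_eqE => /negbTE ->; rewrite mulr0 addr0.
  pose chi A := (psi A * (L A)%:E)%E.
  transitivity (\int[P]_w chi (noise w + V i j *: delta_mx i j)%R)%E.
    by apply: eq_integral => w _; rewrite /chi L_shift.
  rewrite (@ge0_integral_noiseD_delta _ _ _ chi)//; last 2 first.
  - apply: emeasurable_funM => //; apply/measurable_EFinP.
    exact: measurable_prod_lr.
  - move=> A; rewrite /chi mule_ge0// lee_fin prodr_ge0// => kl _.
    exact: normal_lr_ge0.
  apply: eq_integral => w _.
  by rewrite big_cons EFinM -muleA; congr (_ * _)%E; rewrite muleC.
move=> mphi phi0.
have SV : S (index_enum _) = V.
  rewrite [RHS]matrix_sum_delta pair_bigA.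
  by apply: eq_bigr => -[i j] _.
transitivity (\int[P]_w phi (noise w + S (index_enum _))%R)%E.
  by rewrite SV.
by rewrite step ?index_enum_uniq.
Qed.

Definition sqnorm (A : 'M[R]_(m, n)) : R := \sum_i \sum_j A i j ^+ 2.

(** The square is again a likelihood ratio, for the doubled shift, up to a constant. As ratios
    integrate to 1, the second moment is exactly that constant. *)
Lemma noise_lr_sqr V A :
  noise_lr V A ^+ 2 = expR (sqnorm V / sigma ^+ 2) * noise_lr (V + V) A.
Proof.
rewrite /noise_lr -prodrXl /sqnorm pair_bigA /= mulr_suml expR_sum -big_split.
apply: eq_bigr => -[i j] _ /=; rewrite /normal_lr !mxE -expRM_natl -expRD.
by congr expR; field.
Qed.

Lemma integral_noise_lr V : (\int[P]_w (noise_lr V (noise w))%:E = 1)%E.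
Proof.
have := @ge0_integral_noiseD V (cst 1%E) (measurable_cst _) (fun=> lee01).
rewrite integral_cst//= probability_setT mule1 => ->.
by apply: eq_integral => w _; rewrite mul1e.
Qed.

End resampling.

(** * Lower bound for two nearby means *)

(* With L a likelihood ratio, integrating bounds the sum of the two risks below
   by (a - b)^2 (1/2 - E[L^2]/8). *)
Lemma two_point_ineq (R : realType) (e a b L : R) : 0 <= L ->
  (a - b) ^+ 2 / 2 * L <=
  (e - a) ^+ 2 + (e - b) ^+ 2 * L + (a - b) ^+ 2 / 8 * L ^+ 2.
Proof.
move=> L0; rewrite -subr_ge0 -(@pmulr_rge0 _ (1 + L)); last by lra.
(* With [x = e - a] and [y = e - b], one has [(1 + L) (x^2 + L y^2) = (x + L y)^2 + L (a - b)^2].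
   What remains is [(a - b)^2 L / 8] times [L^2 - 3 L + 4], whose square is completed. *)
have -> : (1 + L) * ((e - a) ^+ 2 + (e - b) ^+ 2 * L +
      (a - b) ^+ 2 / 8 * L ^+ 2 - (a - b) ^+ 2 / 2 * L) =
    ((e - a) + L * (e - b)) ^+ 2 +
    (a - b) ^+ 2 * (L * ((L - 3 / 2) ^+ 2 + 7 / 4)) / 8 by field.
rewrite addr_ge0 ?sqr_ge0// divr_ge0// mulr_ge0 ?sqr_ge0// mulr_ge0//.
by rewrite addr_ge0 ?sqr_ge0.
Qed.

Lemma expR_half_le2 (R : realType) (x : R) : x <= 1 / 2 -> expR x <= 2.
Proof.
move=> x2; apply: (@le_trans _ _ (expR (1 / 2))); first by rewrite ler_expR.
(* The tangent bound at [-1/2] gives [exp(-1/2) >= 1/2], which is then inverted. *)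
have := @expR_ge1Dx R (- (1 / 2)); rewrite expRN.
have := @expR_gt0 R (1 / 2); set y := expR _ => y0 y1.
have : (1 / 2) * y <= y^-1 * y by rewrite ler_pM2r//; lra.
by rewrite mulVf ?gt_eqF//; lra.
Qed.

Section two_point.
Context d (T : measurableType d) (R : realType) (P : probability T R).
Context (m n : nat) (sigma : R) (eps : 'I_m * 'I_n -> {RV P >-> R}).
Hypothesis sigma0 : 0 < sigma.
Hypothesis iid : iid_normal sigma eps.

(** Both risks are written under the same noise, the second weighted by the ratio [L]. Integrating
    [two_point_ineq] with [E[L] = 1] and [E[L^2] <= 2] leaves [1/2 - 2/8 = 1/4] of [(a - b)^2]. *)
Lemma two_point_lower_bound (theta V : 'M[R]_(m, n))
    (e : 'M[R]_(m, n) -> R) (a b : R) :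
  measurable_fun setT e -> sqnorm V <= sigma ^+ 2 / 2 ->
  (((a - b) ^+ 2 / 4)%:E <=
   \int[P]_w ((e (noise eps w + theta)%R - a) ^+ 2)%:E +
   \int[P]_w ((e (noise eps w + (theta + V))%R - b) ^+ 2)%:E)%E.
Proof.
move=> me VV.
have s0 : sigma != 0 by rewrite gt_eqF.
have mnoise : measurable_fun setT (noise eps) by exact: measurable_noise.
have meD : measurable_fun setT (fun A : 'M[R]_(m, n) => e (A + theta)).
  exact: (measurableT_comp me (measurable_matrix_addr _)).
have msq c : measurable_fun setT (fun A : 'M[R]_(m, n) =>
    ((e (A + theta) - c) ^+ 2)%:E).
  by apply/measurable_EFinP; apply: measurable_funX; exact: measurable_funB.
have -> : (\int[P]_w ((e (noise eps w + (theta + V))%R - b) ^+ 2)%:E =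
    \int[P]_w ((e (noise eps w + theta)%R - b) ^+ 2 *
      noise_lr sigma V (noise eps w))%:E)%E.
  transitivity (\int[P]_w ((e (noise eps w + V + theta)%R - b) ^+ 2)%:E)%E.
    by apply: eq_integral => w _; rewrite -addrA [V + _]addrC.
  apply: (ge0_integral_noiseD s0 iid V (msq b)) => A.
  by rewrite lee_fin sqr_ge0.
have mL := measurableT_comp (measurable_noise_lr sigma V) mnoise.
(* The second moment is [exp(sqnorm V / sigma^2)], at most [exp(1/2)] by the bound on [V]. *)
have intL2 : (\int[P]_w (noise_lr sigma V (noise eps w) ^+ 2)%:E <= 2%:E)%E.
  under eq_integral do rewrite noise_lr_sqr// EFinM.
  rewrite ge0_integralZl//=; last 2 first.
  - apply/measurable_EFinP.
    exact: (measurableT_comp (measurable_noise_lr sigma (V + V)) mnoise).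
  - by move=> w _; rewrite lee_fin noise_lr_ge0.
  rewrite (integral_noise_lr s0 iid) mule1 lee_fin expR_half_le2//.
  by rewrite ler_pdivrMr ?exprn_gt0// mulrC mulrA mulr1.
set D := (a - b) ^+ 2.
have D0 : 0 <= D by exact: sqr_ge0.
set X := (\int[P]_w _)%E; set Y := (\int[P]_w _)%E.
pose Z := (\int[P]_w (D / 8 * noise_lr sigma V (noise eps w) ^+ 2)%:E)%E.
have ZE : (Z <= (D / 4)%:E)%E.
  rewrite /Z; under eq_integral do rewrite EFinM.
  rewrite ge0_integralZl//=; last 3 first.
  - by apply/measurable_EFinP; exact: measurable_funX.
  - by move=> w _; rewrite lee_fin sqr_ge0.
  - by rewrite lee_fin; lra.
  apply: (@le_trans _ _ ((D / 8)%:E * 2%:E)%E).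
    by apply: lee_wpmul2l => //; rewrite lee_fin; lra.
  by rewrite -EFinM lee_fin; lra.
pose x w := ((e (noise eps w + theta)%R - a) ^+ 2)%:E.
pose y w := ((e (noise eps w + theta)%R - b) ^+ 2 *
  noise_lr sigma V (noise eps w))%:E.
pose z w := (D / 8 * noise_lr sigma V (noise eps w) ^+ 2)%:E.
have mx : measurable_fun setT x by exact: (measurableT_comp (msq a) mnoise).
have my : measurable_fun setT y.
  apply/measurable_EFinP; apply: measurable_funM => //.
  by have /measurable_EFinP := measurableT_comp (msq b) mnoise.
have mz : measurable_fun setT z.
  apply/measurable_EFinP; apply: measurable_funM => //.
  exact: measurable_funX.
have x0 w : (0 <= x w)%E by rewrite lee_fin sqr_ge0.
have y0 w : (0 <= y w)%E by rewrite lee_fin mulr_ge0 ?sqr_ge0 ?noise_lr_ge0.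
have z0 w : (0 <= z w)%E by rewrite lee_fin mulr_ge0 ?sqr_ge0//; lra.
have XYZ : ((D / 2)%:E <= X + Y + Z)%E.
  rewrite -[X in (X <= _)%E]mule1 -(integral_noise_lr s0 iid V).
  rewrite -ge0_integralZl//=; last 3 first.
  - exact/measurable_EFinP.
  - by move=> w _; rewrite lee_fin noise_lr_ge0.
  - by rewrite lee_fin; lra.
  rewrite (_ : X + Y + Z = \int[P]_w (x w + y w + z w))%E; last first.
    rewrite ge0_integralD//; [|by move=> w _; exact: adde_ge0|].
      by rewrite ge0_integralD.
    exact: emeasurable_funD.
  apply: ge0_le_integral => //.
  - move=> w _; rewrite -EFinM lee_fin mulr_ge0 ?noise_lr_ge0//; lra.
  - by apply/measurable_EFinP; exact: measurable_funM.
  - by apply: emeasurable_funD => //; exact: emeasurable_funD.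
  - by move=> w _; rewrite -EFinM lee_fin two_point_ineq ?noise_lr_ge0.
(* The finite bound [D / 4] on [Z] is what gets cancelled, as [X] and [Y] may be infinite. *)
rewrite -(@leeD2rE _ (D / 4)%:E)// -EFinD.
apply: (@le_trans _ _ (X + Y + Z)%E); last exact: leeD2l.
by apply: le_trans XYZ; rewrite lee_fin; lra.
Qed.

End two_point.

(** * The hypercube of anti-Monge matrices *)

Section hypercube.
Context (R : realType) (m1 m2 w : nat) (h : R).
Local Notation n1 := m1.+1.
Local Notation n2 := m2.+1.

(** Block indices live in ['I_n2], so the type of the bit arrays does not depend on [w]. *)
Definition block (j : 'I_n2) : 'I_n2 :=
  Ordinal (leq_ltn_trans (leq_div j w) (ltn_ord j)).

Definition vertex (s : {ffun 'I_n1 * 'I_n2 -> bool}) : 'M[R]_(n1, n2) :=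
  \matrix_(i, j) (2 * h * i%:R * (block j)%:R + h * (s (i, block j))%:R).

Definition flip (kb : 'I_n1 * 'I_n2) (s : {ffun 'I_n1 * 'I_n2 -> bool}) :
    {ffun 'I_n1 * 'I_n2 -> bool} :=
  [ffun x => if x == kb then ~~ s x else s x].

Lemma flipK kb : involutive (flip kb).
Proof.
by move=> s; apply/ffunP => x; rewrite !ffunE; case: eqP; rewrite ?negbK.
Qed.

(** The second difference vanishes within one row or one block. Otherwise the product term
    contributes at least [2 h], and the four bits at least [- 2 h]. *)
Lemma vertex_anti_monge s : 0 <= h -> anti_monge (vertex s).
Proof.
move=> h0 i k j l ik jl; rewrite !mxE.
have [->|bjl] := eqVneq (block j) (block l); first by rewrite addrC.
have bjl1 : ((block j).+1 <= block l)%N.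
  rewrite ltn_neqAle -(inj_eq val_inj) /= in bjl *.
  by rewrite bjl leq_div2r.
move: (block j) (block l) bjl1 => a b ab {bjl jl j l}.
move: ik; rewrite leq_eqVlt => /predU1P[/val_inj ->|ik]; first by rewrite addrC.
have {}ik : i%:R + 1 <= k%:R :> R by rewrite natr1 ler_nat.
have {}ab : a%:R + 1 <= b%:R :> R by rewrite natr1 ler_nat.
have s01 x : 0 <= ((s x)%:R : R) <= 1 by case: (s x); rewrite ?lexx ler01.
have := s01 (i, a); have := s01 (i, b); have := s01 (k, a); have := s01 (k, b).
set t := (s (k, b))%:R; set z := (s (k, a))%:R.
set y := (s (i, b))%:R; set x := (s (i, a))%:R => tP zP yP xP.
have : 1 <= (k%:R - i%:R) * (b%:R - a%:R) :> R.
  by apply: mulr_ege1; lra.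
move: (i%:R) (k%:R) (a%:R) (b%:R) => I K A B IK.
have : 0 <= h * (2 * ((K - I) * (B - A)) + (t + x - z - y)).
  by rewrite mulr_ge0//; lra.
by nra.
Qed.

Lemma vertex_total_var s V0 : 0 <= h -> 0 <= V0 -> (0 < w)%N ->
  (n2 <= w)%N || (2 * h * n1%:R * n2%:R <= V0 * w%:R) ->
  total_var (vertex s) <= V0.
Proof.
move=> h0 V00 w0 wP; rewrite /total_var !mxE.
have [b0|b0] := posnP (m2 %/ w).
  have -> : block ord_max = block ord0 by apply: val_inj; rewrite /= b0 div0n.
  by apply: le_trans V00; rewrite le_eqVlt; apply/orP; left; apply/eqP; ring.
have wn2 : (w <= m2)%N by rewrite leqNgt; apply: contraL b0 => /divn_small ->.
move: wP; rewrite leqNgt ltnS wn2 /= => wP.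
rewrite /= div0n !mulr0 !mul0r !add0r.
have s01 x : 0 <= ((s x)%:R : R) <= 1 by case: (s x); rewrite ?lexx ler01.
have := s01 (ord0, block ord0); have := s01 (ord0, block ord_max).
have := s01 (ord_max, block ord0); have := s01 (ord_max, block ord_max).
set t := (s (ord_max, block ord_max))%:R; set z := (s (ord_max, block ord0))%:R.
set y := (s (ord0, block ord_max))%:R; set x := (s (ord0, block ord0))%:R.
move=> tP zP yP xP.
have w0R : 0 < w%:R :> R by rewrite ltr0n.
apply: (@le_trans _ _ (2 * h * n1%:R * (m2 %/ w)%:R)).
  (* The last block has index [b >= 1], so the bits add at most [2 h <= 2 h b], which raises the
     factor [m1] to [n1]. *)
  have b1 : 1 <= (m2 %/ w)%:R :> R by rewrite ler1n.
  rewrite -[m1.+1%:R]natr1; move: (_ %/ _)%:R b1 => b b1.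
  have : h * (t + x - y - z) <= h * (2 * b) by rewrite ler_wpM2l//; lra.
  move: (m1%:R) => M.
  by lra.
rewrite -(ler_pM2r w0R); apply: le_trans wP.
rewrite -[leLHS]mulrA; apply: ler_wpM2l; first by rewrite !mulr_ge0.
by rewrite -natrM ler_nat (leq_trans (leq_divM _ _)).
Qed.

(** Within a block the quotient by [w] is fixed, so the remainder determines the column. *)
Lemma card_block b : (0 < w)%N -> (#|[pred j | block j == b]| <= w)%N.
Proof.
move=> w0.
pose f (j : 'I_n2) : 'I_w := Ordinal (ltn_pmod j w0).
rewrite -[leqRHS]card_ord -(@card_in_imset _ _ f) ?max_card//.
move=> j l; rewrite !inE => /eqP jb /eqP lb /(congr1 val) /= jl.
apply: val_inj => /=; rewrite (divn_eq j w) (divn_eq l w) jl.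
by have /(congr1 val) /= -> : block j = block l by rewrite jb lb.
Qed.

Lemma sqnorm_vertex_flip s kb : (0 < w)%N ->
  sqnorm (vertex (flip kb s) - vertex s) <= h ^+ 2 * w%:R.
Proof.
case: kb => k b w0.
rewrite /sqnorm (bigD1 k)//= [X in _ + X]big1 ?addr0; last first.
  move=> i ik; rewrite big1// => j _.
  rewrite !mxE ffunE xpair_eqE (negbTE ik)/=.
  by rewrite subrr expr0n.
apply: (@le_trans _ _ (\sum_(j | block j == b) h ^+ 2)); last first.
  rewrite sumr_const -[leLHS]mulr_natr.
  apply: ler_wpM2l; rewrite ?sqr_ge0// ler_nat.
  exact: card_block.
rewrite [leRHS]big_mkcond/=; apply: ler_sum => j _.
rewrite !mxE ffunE xpair_eqE eqxx/=; case: eqP => _.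
  by case: (s _) => /=; rewrite le_eqVlt; apply/orP; left; apply/eqP; ring.
by rewrite subrr expr0n.
Qed.

Lemma vertex_flip_diff s i j :
  (vertex s i j - vertex (flip (i, block j) s) i j) ^+ 2 = h ^+ 2.
Proof. by rewrite !mxE ffunE eqxx; case: (s _) => /=; ring. Qed.

End hypercube.

(** * Assouad's argument and the minimax bound *)

Section assouad.
Context d (T : measurableType d) (R : realType) (P : probability T R).
Context (m1 m2 : nat) (sigma : R).
Variable eps : 'I_m1.+1 * 'I_m2.+1 -> {RV P >-> R}.
Hypothesis sigma0 : 0 < sigma.
Hypothesis iid : iid_normal sigma eps.
Local Notation n1 := m1.+1.
Local Notation n2 := m2.+1.

(** Separates the entries, so that each one can be tested against the flip of its own bit. *)
Lemma riskE (est : {mfun 'M[R]_(n1, n2) >-> 'M[R]_(n1, n2)}) theta :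
  (risk eps est theta = ((n1%:R * n2%:R)^-1)%:E *
    \sum_(ij : 'I_n1 * 'I_n2) \int[P]_w
      ((est (noise eps w + theta)%R ij.1 ij.2 - theta ij.1 ij.2) ^+ 2)%:E)%E.
Proof.
have mest (ij : 'I_n1 * 'I_n2) : measurable_fun setT (fun w =>
    ((est (noise eps w + theta)%R ij.1 ij.2 - theta ij.1 ij.2) ^+ 2)%:E).
  apply/measurable_EFinP; apply: measurable_funX; apply: measurable_funB => //.
  have mobs := measurableT_comp (measurable_matrix_addr theta)
    (measurable_noise eps).
  have mest0 : measurable_fun setT est by exact: measurable_funP.
  have mest := measurableT_comp mest0 mobs.
  exact: (measurableT_comp (measurable_entry ij.1 ij.2) mest).
rewrite -ge0_integral_sum//; last by move=> ij w _; rewrite lee_fin sqr_ge0.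
rewrite -ge0_integralZl//; last 2 first.
- exact: emeasurable_sum.
- by move=> w _; apply: sume_ge0 => ij _; rewrite lee_fin sqr_ge0.
rewrite /risk unlock; apply: eq_integral => w _.
rewrite sumEFin -EFinM /observation -/(noise eps w) [theta + _]addrC.
rewrite /frobenius_norm sqr_sqrtr; last first.
  by do 2 apply: sumr_ge0 => ? _; exact: sqr_ge0.
rewrite pair_bigA /=; congr ((_ * _)%:E).
by apply: eq_bigr => ij _; rewrite !mxE.
Qed.

(** The worst risk dominates the average over all bit arrays. For each entry, pairing [s] with the
    flip of that entry's bit gives two risks of sum at least [h^2 / 4], hence an average of at least
    [h^2 / 8]. *)
Lemma assouad_lower_bound (w : nat) (h M : R)
    (est : {mfun 'M[R]_(n1, n2) >-> 'M[R]_(n1, n2)}) :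
  (0 < w)%N -> h ^+ 2 * w%:R <= sigma ^+ 2 / 2 ->
  (forall s, risk eps est (vertex w h s) <= M%:E)%E -> h ^+ 2 / 8 <= M.
Proof.
move=> w0 hw riskM.
pose F (ij : 'I_n1 * 'I_n2) s := (\int[P]_x
  ((est (noise eps x + vertex w h s)%R ij.1 ij.2
    - vertex w h s ij.1 ij.2) ^+ 2)%:E)%E.
have F0 ij s : (0 <= F ij s)%E.
  by apply: integral_ge0 => x _; rewrite lee_fin sqr_ge0.
have F2 ij s :
    ((h ^+ 2 / 4)%:E <= F ij s + F ij (flip (ij.1, block w ij.2) s))%E.
  have me : measurable_fun setT (fun A => est A ij.1 ij.2).
    exact: (measurableT_comp (measurable_entry ij.1 ij.2)).
  case: ij => i j /= in me *; rewrite -(vertex_flip_diff w h s i j).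
  set s' := flip (i, block w j) s.
  have := @two_point_lower_bound _ _ _ P _ _ sigma eps sigma0 iid (vertex w h s)
    (vertex w h s' - vertex w h s) _ (vertex w h s i j) (vertex w h s' i j) me.
  rewrite [_ + (_ - _)]addrC subrK; apply.
  by apply: le_trans hw; exact: sqnorm_vertex_flip.
set N := #|{ffun 'I_n1 * 'I_n2 -> bool}|.
have N0 : 0 < N%:R :> R.
  by rewrite ltr0n; apply/card_gt0P; exists [ffun=> true].
have sumF ij : ((N%:R * (h ^+ 2 / 8))%:E <= \sum_s F ij s)%E.
  have : ((N%:R * (h ^+ 2 / 4))%:E <= \sum_s F ij s + \sum_s F ij s)%E.
    have flip_inj := inv_inj (flipK (ij.1, block w ij.2)).
    rewrite [X in (_ <= _ + X)%E](reindex_inj flip_inj).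
    rewrite -big_split/=.
    apply: (@le_trans _ _
      (\sum_(s : {ffun 'I_n1 * 'I_n2 -> bool}) (h ^+ 2 / 4)%:E)%E).
      by rewrite sumEFin sumr_const mulr_natl.
    by apply: lee_sum => s _; exact: F2.
  have : (0 <= \sum_s F ij s)%E by apply: sume_ge0.
  (* Halving is done on a finite sum; [+oo] is immediate and [-oo] is excluded by nonnegativity. *)
  case: (\sum_s F ij s)%E => [r| |] //; last by move=> *; exact: leey.
  by rewrite -EFinD !lee_fin; lra.
have n12 : 0 < n1%:R * n2%:R :> R by rewrite mulr_gt0.
have : ((N%:R * (h ^+ 2 / 8))%:E <= (N%:R * M)%:E)%E.
  apply: (@le_trans _ _ (\sum_s risk eps est (vertex w h s))%E); last first.
    apply: (@le_trans _ _ (\sum_(s : {ffun 'I_n1 * 'I_n2 -> bool}) M%:E)%E).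
      by apply: lee_sum => s _; exact: riskM.
    by rewrite sumEFin sumr_const mulr_natl.
  under eq_bigr do rewrite riskE.
  rewrite -ge0_sume_distrr; last first.
    by move=> s _; apply: sume_ge0 => ij _; exact: F0.
  rewrite exchange_big/= lee_pdivlMl//.
  apply: (@le_trans _ _ (\sum_(ij : 'I_n1 * 'I_n2) (N%:R * (h ^+ 2 / 8))%:E)%E).
    rewrite sumEFin sumr_const card_prod !card_ord -EFinM lee_fin.
    by rewrite -[leRHS]mulr_natl natrM.
  by apply: lee_sum => ij _; exact: sumF.
by rewrite lee_fin ler_pM2l.
Qed.

Lemma minimax_lower_bound (w : nat) (h V0 : R) :
  0 <= h -> 0 <= V0 -> (0 < w)%N -> h ^+ 2 * w%:R <= sigma ^+ 2 / 2 ->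
  (n2 <= w)%N || (2 * h * n1%:R * n2%:R <= V0 * w%:R) ->
  ((h ^+ 2 / 8)%:E <= minimax_risk eps V0)%E.
Proof.
move=> h0 V00 w0 hw wP; apply: le_ereal_inf_tmp => _ [est _ <-].
set S := ereal_sup _.
have riskS s : (risk eps est (vertex w h s) <= S)%E.
  apply: ereal_sup_ubound; exists (vertex w h s) => //; split.
    exact: vertex_anti_monge.
  exact: vertex_total_var.
(* Excludes [S = -oo]; the case [+oo] is trivial, and a finite [S] serves as [M]. *)
have : (0 <= S)%E.
  apply: le_trans (riskS [ffun=> true]); rewrite riskE mule_ge0//.
  apply: sume_ge0 => ij _; apply: integral_ge0 => x _.
  by rewrite lee_fin sqr_ge0.
case: S riskS => [M| |]// riskM _; last by rewrite leey.
by rewrite lee_fin (assouad_lower_bound w0 hw riskM).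
Qed.

End assouad.

(** * The block width and the rate *)

Lemma powR_twothirds_le (R : realType) (x y : R) :
  0 <= x -> 0 <= y -> x ^+ 2 <= y ^+ 3 -> x `^ (2%:R / 3%:R) <= y.
Proof.
move=> x0 y0 xy; rewrite powRrM powR_mulrn//.
apply: (@le_trans _ _ ((y ^+ 3) `^ 3%:R^-1)).
  by apply: ge0_ler_powR => //; rewrite nnegrE exprn_ge0.
by rewrite -powR_mulrn// -powRrM mulfV ?powRr1// pnatr_eq0.
Qed.

(** The second alternative is the total variation constraint for [h^2 = sigma^2 / (2 w)], squared
    and multiplied by [w]. The least admissible [w] is taken, and the failure of [w - 1] bounds the
    rate. *)
Lemma block_width_exists (R : realType) (n1 n2 : nat) (sigma V0 : R) :
  (0 < n1)%N -> (0 < n2)%N -> 0 < sigma -> 0 <= V0 ->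
  exists w : nat, [/\ (0 < w)%N,
    (n2 <= w)%N ||
      (2 * sigma ^+ 2 * (n1%:R * n2%:R) ^+ 2 <= V0 ^+ 2 * w%:R ^+ 3) &
    Num.min (sigma ^+ 2 / n2%:R
             + (sigma ^+ 2 * V0 / (n1%:R * n2%:R)) `^ (2%:R / 3%:R))
            (sigma ^+ 2) <= 5 * (sigma ^+ 2 / w%:R)].
Proof.
move=> n1_gt0 n2_gt0 s0 V00.
pose wide w := (n2 <= w)%N ||
  (2 * sigma ^+ 2 * (n1%:R * n2%:R) ^+ 2 <= V0 ^+ 2 * w%:R ^+ 3).
have ex_wide : exists w, (0 < w)%N && wide w.
  by exists n2; rewrite n2_gt0 /wide leqnn.
case: (ex_minnP ex_wide) => w /andP[w0 w_wide] w_min; exists w; split => //.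
have S0 : 0 < sigma ^+ 2 by rewrite exprn_gt0.
(* Width 1 is covered by the term [sigma^2] of the minimum. Afterwards the width is [w.+2], and
   [w.+1] violates both alternatives. *)
case: w => [//|[|w]] in w0 w_wide w_min *.
  by rewrite ge_min divr1; apply/orP; right; lra.
have : ~~ wide w.+1.
  by apply/negP => ww; have := w_min w.+1; rewrite ww ltnn => /(_ isT).
rewrite negb_or -ltnNge -ltNge => /andP[wn2 wV].
rewrite ge_min; apply/orP; left.
have n12 : 0 < n1%:R * n2%:R :> R by rewrite mulr_gt0 ?ltr0n.
have w1 : 1 <= w.+1%:R :> R by rewrite ler1n.
have S1 : sigma ^+ 2 / n2%:R <= sigma ^+ 2 / w.+2%:R.
  by rewrite ler_pM2l// lef_pV2 ?posrE ?ltr0n// ler_nat.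
have S2 : (sigma ^+ 2 * V0 / (n1%:R * n2%:R)) `^ (2%:R / 3%:R) <=
    2 * (sigma ^+ 2 / w.+1%:R).
  apply: powR_twothirds_le.
  - by apply: divr_ge0; [apply: mulr_ge0 => //|]; exact: ltW.
  - by apply: mulr_ge0 => //; apply: divr_ge0; apply: ltW => //; lra.
  move: wV S0 w1.
  move: (sigma ^+ 2) (w.+1%:R) (_ * _) n12 => S W N n12 wV S0 w1.
  have W0 : 0 < W by lra.
  rewrite -subr_ge0.
  (* The failed constraint makes [(S V0 / N)^2] less than [2 (S / W)^3]. The factor 2 in the bound
     has cube 8, and the surplus is the term with coefficient 6. *)
  have -> : (2 * (S / W)) ^+ 3 - (S * V0 / N) ^+ 2 =
      (S ^+ 2 * (2 * S * N ^+ 2 - V0 ^+ 2 * W ^+ 3) + 6 * (S ^+ 3 * N ^+ 2)) /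
      (N ^+ 2 * W ^+ 3) by field; rewrite !gt_eqF.
  apply: divr_ge0; last by rewrite mulr_ge0 ?exprn_ge0 ?ltW.
  apply: addr_ge0; first by rewrite mulr_ge0 ?sqr_ge0 ?subr_ge0 ?ltW.
  by rewrite !mulr_ge0 ?exprn_ge0 ?ltW.
(* Returning from [w - 1] to the width [w >= 2] costs a factor 2, whence the total [1 + 4 = 5]. *)
have S3 : 2 * (sigma ^+ 2 / w.+1%:R) <= 4 * (sigma ^+ 2 / w.+2%:R).
  have W0 : 0 < w.+1%:R :> R by lra.
  rewrite !mulrA ler_pdivlMr ?ltr0n// mulrAC ler_pdivrMr// -[w.+2%:R]natr1.
  by move: (w.+1%:R) w1 => W W1; nra.
apply: (le_trans (lerD S1 (le_trans S2 S3))).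
by move: (_ / w.+2%:R) => z; lra.
Qed.

Theorem theorem2 (R : realType) :
  exists c : R, 0 < c /\
  forall (m1 m2 : nat) (sigma V0 : R),
    (m2 <= m1)%N -> 0 < sigma -> 0 <= V0 ->
  let n1 := m1.+1 in let n2 := m2.+1 in
  forall (d : measure_display) (T : measurableType d) (P : probability T R)
    (eps : 'I_n1 * 'I_n2 -> {RV P >-> R}),
    iid_normal sigma eps ->
  ((c * Num.min (sigma ^+ 2 / n2%:R
                 + (sigma ^+ 2 * V0 / (n1%:R * n2%:R)) `^ (2%:R / 3%:R))
                (sigma ^+ 2))%:E
   <= minimax_risk eps V0)%E.
Proof.
(* Here [80 = 2 * 8 * 5]: 2 from [h^2], 8 from Assouad's bound, 5 from the comparison with the
   rate. *)
exists (80%:R^-1); split; first by rewrite invr_gt0.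
move=> m1 m2 sigma V0 _ s0 V00; lazy zeta => d T P eps iid.
have [w [w0 w_wide w_rate]] :=
  block_width_exists (ltn0Sn m1) (ltn0Sn m2) s0 V00.
have wR : 0 < w%:R :> R by rewrite ltr0n.
(* The largest amplitude for which a flipped bit stays undetectable, with equality in [hw]. *)
pose h := Num.sqrt (sigma ^+ 2 / (2 * w%:R)).
have h0 : 0 <= h by exact: sqrtr_ge0.
have hE : h ^+ 2 = sigma ^+ 2 / (2 * w%:R).
  by rewrite sqr_sqrtr// divr_ge0 ?sqr_ge0// mulr_ge0// ltW.
have hw : h ^+ 2 * w%:R <= sigma ^+ 2 / 2.
  by rewrite hE le_eqVlt; apply/orP; left; apply/eqP; field; rewrite gt_eqF.
have wP : (m2.+1 <= w)%N || (2 * h * m1.+1%:R * m2.+1%:R <= V0 * w%:R).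
  case/orP: w_wide => [->//|Vw]; apply/orP; right.
  have hn0 : 0 <= 2 * h * m1.+1%:R * m2.+1%:R by rewrite !mulr_ge0.
  have Vw0 : 0 <= V0 * w%:R by rewrite mulr_ge0.
  (* Squaring removes the root in [h], and multiplying by [w] clears the denominator of [h^2], which
     gives the constraint [Vw]. *)
  rewrite -ler_sqr ?nnegrE//.
  rewrite -(ler_pM2r wR); apply: le_trans (_ : V0 ^+ 2 * w%:R ^+ 3 <= _).
    apply: le_trans Vw; rewrite -[leLHS]mulr1 !exprMn hE le_eqVlt.
    by apply/orP; left; apply/eqP; field; rewrite gt_eqF.
  by rewrite le_eqVlt; apply/orP; left; apply/eqP; ring.
apply: le_trans (minimax_lower_bound s0 iid h0 V00 w0 hw wP).
rewrite lee_fin hE.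
have -> : sigma ^+ 2 / (2 * w%:R) / 8 = 80%:R^-1 * (5 * (sigma ^+ 2 / w%:R)).
  by field; rewrite gt_eqF.
by rewrite ler_pM2l ?invr_gt0.
Qed.
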